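(* Let $K$ be a finite field, let $G$ be a graph and let $X$ be the projective toric subset parameterized by $G$. Let $H_1,H_2\subset G$ be subgraphs such that $E_G=E_{H_1}\cup E_{H_2}$ and $E_{H_1}\cap E_{H_2}\neq\emptyset$. Let $X_1$ and $X_2$ be the projective toric subsets parameterized by $H_1$ and $H_2$, and $I(X_1)\subset K[E_{H_1}]$, $I(X_2)\subset K[E_{H_2}]$ their corresponding vanishing ideals. Then $$\operatorname{reg} K[E_G]/I(X)\leq \operatorname{reg} K[E_{H_1}]/I(X_1) + \operatorname{reg} K[E_{H_2}]/I(X_2).$$
   Context: Graphs are finite, undirected and without loops; multiple edges are allowed. $V_G$ and $E_G$ denote the vertex set and edge set of $G$; it is assumed that $G$ has no isolated vertices. For a graph $G$ with $s=|E_G|\geq 1$ edges, fix an identification of $E_G$ with the variables $t_1,\dots,t_s$ of the standard graded polynomial ring $K[t_1,\dots,t_s]$, which is then denoted $K[E_G]$. If $H$ is a subgraph of $G$, $K[E_H]\subset K[E_G]$ is the polynomial subring on the variables corresponding to the edges of $H$. For $\mathbf{x}=(x_v)_{v\in V_G}\in (K^* )^{V_G}$ and an edge $t_i=\{v,w\}$ put $\mathbf{x}^{t_i}=x_vx_w$. The projective toric subset parameterized by $G$ is $$X=\{(\mathbf{x}^{t_1},\dots,\mathbf{x}^{t_s})\in \mathbb{P}^{s-1}(K) \mid \mathbf{x}\in (K^* )^{V_G}\},$$ and $I(X)\subset K[E_G]$ is its vanishing ideal, i.e. the ideal generated by all homogeneous polynomials vanishing on $X$. The same definitions apply to subgraphs.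 The Castelnuovo--Mumford regularity of a finitely generated graded module $M$ over a standard graded polynomial ring $S$, with minimal graded free resolution $0\to F_c\to\cdots\to F_0\to M\to 0$, $F_i\cong\bigoplus_{j} S(-j)^{b_{ij}}$, is $\operatorname{reg} M=\max\{j-i \mid b_{ij}\neq 0\}$. Here $K[E_{H_i}]/I(X_i)$ is regarded as a graded $K[E_{H_i}]$-module. *)

(* Defs.v *)
From HB Require Import structures.
From mathcomp Require Import all_boot all_order all_algebra.
From mathcomp Require Import mpoly.

Set Implicit Arguments.
Unset Strict Implicit.
Unset Printing Implicit Defensive.

Import GRing.Theory Num.Theory.
Local Open Scope ring_scope.

(* A finite loopless multigraph whose vertices and edges are drawn from the
   finite types [V] and [E].  Distinct edges may have the same ends; the values
   of [ends] outside [edges] are irrelevant. *)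
Record graph (V E : finType) := Graph {
  verts : {set V};
  edges : {set E};
  ends : E -> {set V};
  ends_sub : forall e, e \in edges -> ends e \subset verts;
  ends_card : forall e, e \in edges -> #|ends e| = 2%N
}.

Definition no_isolated_vertex (V E : finType) (G : graph V E) : Prop :=
  forall v, v \in verts G -> exists2 e, e \in edges G & v \in ends G e.

Definition subgraph (V E : finType) (H G : graph V E) : Prop :=
  [/\ verts H \subset verts G, edges H \subset edges G
    & forall e, e \in edges H -> ends H e = ends G e].

Section Ideals.
Variables (R : comNzRingType) (P : R -> Prop).

Definition ideal_generated_by (f : R) : Prop :=
  exists (m : nat) (c g : 'I_m -> R),
    (forall i, P (g i)) /\ f = \sum_(i < m) c i * g i.

End Ideals.

Section Toric.
Variables (K : finFieldType) (V E : finType) (G : graph V E).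

(* K[E_G]: the variable 'X_i corresponds to the edge [enum_val i]. *)
Definition edge_ring := {mpoly K[#|edges G|]}.

Definition edge_monomial (x : V -> K) (e : E) : K := \prod_(v in ends G e) x v.

Definition toric_vector (x : V -> K) : 'rV[K]_#|edges G| :=
  \row_i edge_monomial x (enum_val i).

(* Points of the projective space P^(s-1)(K) are the lines (one-dimensional
   subspaces) of K^s.  Only the values of [x] on the vertices of G matter. *)
Definition toric_subset (L : {vspace 'rV[K]_#|edges G|}) : Prop :=
  exists2 x : V -> K,
    (forall v, v \in verts G -> x v != 0) & L = <[toric_vector x]>%VS.

(* A homogeneous polynomial vanishes at a projective point when it vanishes at
   all (equivalently, some) homogeneous coordinates of that point. *)
Definition vanishes_at (f : edge_ring) (L : {vspace 'rV[K]_#|edges G|}) : Prop :=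
  forall p, p \in L -> p != 0 -> f.@[fun i => p 0 i] = 0.

Definition homogeneous_vanishing (f : edge_ring) : Prop :=
  (exists d : nat, f \is d.-homog) /\
  (forall L, toric_subset L -> vanishes_at f L).

Definition vanishing_ideal : edge_ring -> Prop :=
  ideal_generated_by homogeneous_vanishing.

End Toric.

Arguments vanishing_ideal K {V E} G f.

Section Regularity.
Variables (K : fieldType) (n : nat).
Local Notation S := {mpoly K[n]}.

(* The elements of degree [d] of S, seen as a Z-graded ring. *)
Definition zhomog (d : int) (p : S) : Prop :=
  match d with
  | Posz e => p \is e.-homog
  | Negz _ => p = 0
  end.

(* Graded free modules F_i = (+)_a S(- shift i a) with maps F_(i+1) -> F_i and
   F_0 -> S.  Elements of F_i are row vectors and the maps act by right
   multiplication; the last one is a lift of the augmentation F_0 -> S/I. *)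
Record free_sequence := FreeSequence {
  rank : nat -> nat;
  shift : forall i, 'I_(rank i) -> int;
  diff : forall i, 'M[S]_(rank i.+1, rank i);
  aug : 'cV[S]_(rank 0)
}.

(* b_ij, the number of summands S(-j) of F_i *)
Definition betti (F : free_sequence) (i : nat) (j : int) : nat :=
  #|[set a : 'I_(rank F i) | shift a == j]|.

(* [F] is a minimal graded free resolution of finite length
     0 -> F_c -> ... -> F_1 -> F_0 -> S/I -> 0
   of the cyclic module S/I, where I is a homogeneous ideal.  Equality in S/I is
   congruence modulo I.  The maps have degree 0, and minimality means that
   F_(i+1) is mapped into m F_i, where m is the irrelevant ideal. *)
Record minimal_graded_free_resolution
    (I : S -> Prop) (F : free_sequence) : Prop := MinimalGradedFreeResolution {
  res_finite : exists c : nat, forall i, (c < i)%N -> rank F i = 0%N;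
  res_diff_graded : forall i (a : 'I_(rank F i.+1)) (b : 'I_(rank F i)),
    zhomog (shift a - shift b) (diff F i a b);
  res_aug_graded : forall a : 'I_(rank F 0), zhomog (shift a) (aug F a 0);
  res_aug_surj : forall f : S,
    exists v : 'rV[S]_(rank F 0), I (f - (v *m aug F) 0 0);
  res_exact0 : forall v : 'rV[S]_(rank F 0),
    I ((v *m aug F) 0 0) <-> exists w, v = w *m diff F 0;
  res_exact : forall i (v : 'rV[S]_(rank F i.+1)),
    v *m diff F i = 0 <-> exists w, v = w *m diff F i.+1;
  res_minimal : forall i (a : 'I_(rank F i.+1)) (b : 'I_(rank F i)),
    (diff F i a b)@_0%MM = 0
}.

(* reg S/I = r.  A relation, because it is read off any minimal graded free
   resolution; one exists and it is unique up to isomorphism. *)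
Definition regularity (I : S -> Prop) (r : int) : Prop :=
  exists2 F : free_sequence,
    minimal_graded_free_resolution I F
    & (exists (i : nat) (j : int), betti F i j != 0%N /\ r = j - i%:Z) /\
      (forall (i : nat) (j : int), betti F i j != 0%N -> j - i%:Z <= r).

End Regularity.

(* Main.v *)
(** Fix a variable t.  Since the points of X have nonzero coordinates, t is a
    nonzerodivisor on M = S/I(X), and since x^(q-1) = 1 on K^*, the ring
    M/tM has finite length.  Then reg M is the top degree of M/tM, i.e. reg M <= N
    iff every monomial of degree > N lies in tS + I(X).  Applied with t an edge
    of both H_1 and H_2 this gives the theorem: a monomial of degree > r1 + r2
    is the product of one in the edges of H_1 and one in the edges of H_2, and
    either the first has degree > r1 or the second has degree > r2.

    The description of reg M is obtained from the double complex
    (Koszul complex) (x) (minimal resolution F), whose columns and rows are exact.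
    Let P(q) say that the Koszul homology of coker(F_(q+1) -> F_q) vanishes when
    its coefficients have degree > N + q.  Minimality of F gives
    P(q) -> P(q+1), the bound j - i <= N on the generators gives P(q+1) -> P(q),
    P(q) is trivial for large q, and P(q) bounds the degrees of the
    generators of F_q by N + q.  Finally P(0) is the vanishing of M/tM in degrees
    > N, as multiplication by t is null-homotopic on the Koszul complex. *)

From HB Require Import structures.
Require Import Defs.
From mathcomp Require Import all_boot all_order all_algebra finfield.
From mathcomp Require Import mpoly ring zify.

Set Implicit Arguments.
Unset Strict Implicit.
Unset Printing Implicit Defensive.

Import Order.TTheory GRing.Theory Num.Theory.
Local Open Scope ring_scope.

(** * Koszul complexes *)

Section Koszul.
Variable R : comNzRingType.
Implicit Types (V W : lmodType R) (xs : seq R) (x : R).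

(* [koszul V xs] is the Koszul complex of [xs] on [V], as an iterated mapping
   cone: [(a, b)] stands for [a + e_x /\ b]. *)
Fixpoint koszul V xs : lmodType R :=
  if xs is _ :: xs' then (koszul V xs' * koszul V xs')%type else V.

(** The sign comes from d(e_x /\ b) = x b - e_x /\ d b. The exterior degree is not recorded: a chain
    may mix exterior degrees. *)
Fixpoint kdiff V xs : koszul V xs -> koszul V xs :=
  match xs return koszul V xs -> koszul V xs with
  | [::] => fun=> 0
  | x :: xs' => fun u => (kdiff u.1 + x *: u.2, - kdiff u.2)
  end.

Fixpoint kall V (N : V -> Prop) xs : koszul V xs -> Prop :=
  match xs return koszul V xs -> Prop with
  | [::] => N
  | x :: xs' => fun u => kall N u.1 /\ kall N u.2
  end.

Fixpoint kmap V W (f : V -> W) xs : koszul V xs -> koszul W xs :=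
  match xs return koszul V xs -> koszul W xs with
  | [::] => f
  | x :: xs' => fun u => (kmap f u.1, kmap f u.2)
  end.

(* [kinj] and [kaug] are the inclusion of and projection to exterior degree 0,
   [ktop] and [kcotop] those of the top exterior degree. *)
Fixpoint kinj V xs (v : V) : koszul V xs :=
  match xs return koszul V xs with
  | [::] => v
  | x :: xs' => (kinj xs' v, 0)
  end.

Fixpoint kaug V xs : koszul V xs -> V :=
  match xs return koszul V xs -> V with
  | [::] => id
  | x :: xs' => fun u => kaug u.1
  end.

Fixpoint ktop V xs (v : V) : koszul V xs :=
  match xs return koszul V xs with
  | [::] => v
  | x :: xs' => (0, ktop xs' v)
  end.

Fixpoint kcotop V xs : koszul V xs -> V :=
  match xs return koszul V xs -> V with
  | [::] => id
  | x :: xs' => fun u => kcotop u.2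
  end.

Lemma kdiff_is_linear V xs : linear (@kdiff V xs).
Proof.
elim: xs => [|x xs IH] k u v /=; first by rewrite scaler0 addr0.
rewrite !IH; congr pair; rewrite /= ?opprD ?scalerN //.
rewrite !scalerDr !scalerA addrACA; congr (_ + (_ + _)).
by rewrite mulrC.
Qed.

HB.instance Definition _ V xs :=
  GRing.isLinear.Build R (koszul V xs) (koszul V xs) _ (@kdiff V xs)
    (@kdiff_is_linear V xs).

Lemma kaug_is_linear V xs : linear (@kaug V xs).
Proof. by elim: xs => [|x xs IH] k u v //=; rewrite IH. Qed.

HB.instance Definition _ V xs :=
  GRing.isLinear.Build R (koszul V xs) V _ (@kaug V xs) (@kaug_is_linear V xs).

Lemma kcotop_is_linear V xs : linear (@kcotop V xs).
Proof. by elim: xs => [|x xs IH] k u v //=; rewrite IH. Qed.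

HB.instance Definition _ V xs :=
  GRing.isLinear.Build R (koszul V xs) V _ (@kcotop V xs)
    (@kcotop_is_linear V xs).

Lemma kmap_is_linear V W (f : {linear V -> W}) xs : linear (@kmap V W f xs).
Proof.
elim: xs => [|x xs IH] k u v /=; first by rewrite linearP.
by rewrite !IH.
Qed.

HB.instance Definition _ V W (f : {linear V -> W}) xs :=
  GRing.isLinear.Build R (koszul V xs) (koszul W xs) _ (@kmap V W f xs)
    (@kmap_is_linear V W f xs).

(* Instances of [linear*] for [rewrite]: cleaning up after [linearD] with [/=]
   would also unfold [kdiff] and [kmap] on a list [x :: xs]. *)
Lemma kdiff0 V xs : kdiff (0 : koszul V xs) = 0.
Proof. exact: linear0. Qed.

Lemma kdiffD V xs (u v : koszul V xs) : kdiff (u + v) = kdiff u + kdiff v.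
Proof. exact: linearD. Qed.

Lemma kdiffB V xs (u v : koszul V xs) : kdiff (u - v) = kdiff u - kdiff v.
Proof. exact: linearB. Qed.

Lemma kdiffZ V xs x (u : koszul V xs) : kdiff (x *: u) = x *: kdiff u.
Proof. exact: linearZ. Qed.

Lemma kaugD V xs (u v : koszul V xs) : kaug (u + v) = kaug u + kaug v.
Proof. exact: linearD. Qed.

Lemma kaugB V xs (u v : koszul V xs) : kaug (u - v) = kaug u - kaug v.
Proof. exact: linearB. Qed.

Lemma kmap0 V W (f : {linear V -> W}) xs : kmap f (0 : koszul V xs) = 0.
Proof. exact: linear0. Qed.

Lemma kmapD V W (f : {linear V -> W}) xs (u v : koszul V xs) :
  kmap f (u + v) = kmap f u + kmap f v.
Proof. exact: linearD. Qed.

Lemma kmapZ V W (f : {linear V -> W}) xs x (u : koszul V xs) :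
  kmap f (x *: u) = x *: kmap f u.
Proof. exact: linearZ. Qed.

Lemma kmapB V W (f : {linear V -> W}) xs (u v : koszul V xs) :
  kmap f (u - v) = kmap f u - kmap f v.
Proof. exact: linearB. Qed.

Lemma kdiffK V xs (u : koszul V xs) : kdiff (kdiff u) = 0.
Proof.
elim: xs u => [|x xs IH] u //=.
by rewrite scalerN linearD linearN linearZ /= !IH add0r subrr !oppr0; apply: erefl.
Qed.

Definition khomotopy V x xs (u : koszul V (x :: xs)) : koszul V (x :: xs) :=
  (0, u.1).

(** [khomotopy] is exterior multiplication by e_x. The two terms e_x /\ d a cancel, which leaves x a
    + e_x /\ x b. *)
Lemma khomotopyP V x xs (u : koszul V (x :: xs)) :
  x *: u = kdiff (khomotopy u) + khomotopy (kdiff u).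
Proof.
case: u => a b /=; congr pair; rewrite /= ?kdiff0 ?add0r ?addr0 //.
by rewrite addKr.
Qed.

Lemma kdiff_map V W (f : {linear V -> W}) xs (u : koszul V xs) :
  kdiff (kmap f u) = kmap f (kdiff u).
Proof.
elim: xs u => [|x xs IH] u /=; first by rewrite linear0.
by rewrite !IH linearD linearZ linearN.
Qed.

Lemma kmap_comp0 V1 V2 V3 (f : V1 -> V2) (g : V2 -> V3) xs (u : koszul V1 xs) :
  (forall v, g (f v) = 0) -> kmap g (kmap f u) = 0.
Proof. by move=> gf0; elim: xs u => [|x xs IH] u //=; rewrite !IH. Qed.

Lemma kaug_map V W (f : V -> W) xs (u : koszul V xs) :
  kaug (kmap f u) = f (kaug u).
Proof. by elim: xs u => [|x xs IH] u /=. Qed.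

Lemma kdiff_inj V xs (v : V) : kdiff (kinj xs v) = 0.
Proof.
by elim: xs => [|x xs IH] //=; rewrite IH scaler0 add0r linear0 oppr0; apply: erefl.
Qed.

Lemma kaug_inj V xs (v : V) : kaug (kinj xs v) = v.
Proof. by elim: xs. Qed.

Lemma kcotop_top V xs (v : V) : kcotop (ktop xs v) = v.
Proof. by elim: xs. Qed.

Lemma kcotop_diff V xs (u : koszul V xs) : kcotop (kdiff u) = 0.
Proof. by elim: xs u => [|x xs IH] u //=; rewrite linearN /= IH oppr0. Qed.

(** The left side is the coefficient of the product of all generators but e_x. Only x b contributes
    to it, since d a has no top coefficient. *)
Lemma kcotop_diff1 V x xs (u : koszul V (x :: xs)) :
  kcotop (kdiff u).1 = x *: kcotop u.
Proof. by rewrite /= linearD linearZ /= kcotop_diff add0r. Qed.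

(** * Conditions on all coefficients of a Koszul chain *)

Lemma kall_impl V (N N' : V -> Prop) xs (u : koszul V xs) :
  (forall v, N v -> N' v) -> kall N u -> kall N' u.
Proof.
move=> NN'; elim: xs u => [|x xs IH] u /=; first exact: NN'.
by case=> /IH u1 /IH u2.
Qed.

Lemma kall0 V (N : V -> Prop) xs : N 0 -> kall N (0 : koszul V xs).
Proof. by move=> N0; elim: xs => [|x xs IH] /=. Qed.

Lemma kallD V (N N1 N2 : V -> Prop) xs (u v : koszul V xs) :
  (forall a b, N1 a -> N2 b -> N (a + b)) ->
  kall N1 u -> kall N2 v -> kall N (u + v).
Proof.
move=> ND; elim: xs u v => [|x xs IH] u v /=; first exact: ND.
by case=> u1 u2 [v1 v2]; split; apply: IH.
Qed.

Lemma kallZ V (N N' : V -> Prop) x xs (u : koszul V xs) :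
  (forall a, N a -> N' (x *: a)) -> kall N u -> kall N' (x *: u).
Proof.
move=> NZ; elim: xs u => [|y xs IH] u /=; first exact: NZ.
by case=> u1 u2; split; apply: IH.
Qed.

Lemma kallN V (N : V -> Prop) xs (u : koszul V xs) :
  (forall a, N a -> N (- a)) -> kall N u -> kall N (- u).
Proof.
move=> NN; rewrite -scaleN1r; apply: kallZ => a.
by rewrite scaleN1r; apply: NN.
Qed.

Lemma kall_diff V (N N' : V -> Prop) xs (u : koszul V xs) :
  N' 0 -> (forall a b, N' a -> N' b -> N' (a + b)) ->
  (forall a, N' a -> N' (- a)) ->
  (forall x a, x \in xs -> N a -> N' (x *: a)) ->
  kall N u -> kall N' (kdiff u).
Proof.
move=> N0 ND NN; elim: xs u => [|x xs IH] //= u NZ [Nu1 Nu2].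
have {}IH (v : koszul V xs) : kall N v -> kall N' (kdiff v).
  by apply: IH => y a yxs; apply: NZ; rewrite inE yxs orbT.
split; last by apply: kallN => //; apply: IH.
apply: kallD ND _ _; first exact: IH.
by apply: kallZ Nu2 => a; apply: NZ; rewrite mem_head.
Qed.

Lemma kall_inj V (N : V -> Prop) xs v : N 0 -> N v -> kall N (kinj xs v).
Proof. by move=> N0 Nv; elim: xs => //= x xs IH; split=> //; apply: kall0. Qed.

Lemma kall_top V (N : V -> Prop) xs v : N 0 -> N v -> kall N (ktop xs v).
Proof. by move=> N0 Nv; elim: xs => //= x xs IH; split=> //; apply: kall0. Qed.

Lemma kall_homotopy V (N : V -> Prop) x xs (u : koszul V (x :: xs)) :
  N 0 -> kall N u -> kall N (khomotopy u).
Proof. by move=> N0 [u1 _]; split=> //; apply: kall0. Qed.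

Lemma kall_aug V (N : V -> Prop) xs (u : koszul V xs) : kall N u -> N (kaug u).
Proof. by elim: xs u => [|x xs IH] u //= [/IH]. Qed.

Lemma kall_cotop V (N : V -> Prop) xs (u : koszul V xs) :
  kall N u -> N (kcotop u).
Proof. by elim: xs u => [|x xs IH] u //= [_ /IH]. Qed.

Lemma kall_map V W (N : W -> Prop) (f : V -> W) xs (u : koszul V xs) :
  kall N (kmap f u) <-> kall (fun v => N (f v)) u.
Proof. by elim: xs u => [|x xs IH] u //=; rewrite !IH. Qed.

Lemma kall_choice V W (N : W -> Prop) (N1 : V -> Prop) (f : {linear V -> W}) xs
    (u : koszul W xs) :
  (forall w, N w -> exists2 v, N1 v & w = f v) ->
  kall N u -> exists2 v, kall N1 v & u = kmap f v.
Proof.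
move=> Nf; elim: xs u => [|x xs IH] u /=; first exact: Nf.
case: u => a b /= [/IH [v1 Nv1 ->] /IH [v2 Nv2 ->]].
by exists (v1, v2).
Qed.

Lemma koszul_eq0 V xs (u : koszul V xs) : kall (fun v => v = 0) u -> u = 0.
Proof.
elim: xs u => [|x xs IH] u //=.
by case: u => a b /= [/IH -> /IH ->].
Qed.

End Koszul.

(** * Graded modules and exactness of the Koszul complex *)

Section Graded.
Variables (K : fieldType) (n : nat).
Local Notation S := {mpoly K[n]}.
Implicit Types (p q : S) (m : 'X_{1..n}) (c e : int).

Definition mfilter (P : pred 'X_{1..n}) p : S :=
  \sum_(m <- msupp p | P m) p@_m *: 'X_[m].

Lemma mcoeff_mfilter (P : pred 'X_{1..n}) p m :
  (mfilter P p)@_m = if P m then p@_m else 0.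
Proof.
rewrite /mfilter raddf_sum /=.
under eq_bigr do rewrite mcoeffZ mcoeffX.
have [msp|msp] := boolP (m \in msupp p); last first.
  rewrite (memN_msupp_eq0 msp) if_same big_seq_cond big1 // => k /andP[ks _].
  by case: eqVneq ks => [->|]; rewrite ?mulr0 // (negPf msp).
rewrite big_mkcond (bigD1_seq m) //= eqxx mulr1 big1 ?addr0 // => k /negPf km.
by rewrite km mulr0 if_same.
Qed.

Lemma zhomogP c p :
  zhomog c p <-> forall m, p@_m != 0 -> (mdeg m)%:Z = c.
Proof.
case: c => c; split=> /= [|H].
- by move=> /dhomogP H m; rewrite -mcoeff_msupp => /H ->.
- by apply/dhomogP => m; rewrite mcoeff_msupp => /H [].
- by move=> -> m; rewrite mcoeff0 eqxx.
- apply/mpolyP => m; rewrite mcoeff0; apply/eqP; apply: contraT => /H.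
  by case: c H.
Qed.

Lemma zhomog_coeff0 c p m : zhomog c p -> (mdeg m)%:Z != c -> p@_m = 0.
Proof.
by move/zhomogP => H; apply: contraNeq => /H ->.
Qed.

Lemma zhomog0 c : zhomog c (0 : S).
Proof. by apply/zhomogP => m; rewrite mcoeff0 eqxx. Qed.

Lemma zhomogD c p q : zhomog c p -> zhomog c q -> zhomog c (p + q).
Proof. by case: c => c /=; [exact: rpredD | move=> -> ->; rewrite addr0]. Qed.

Lemma zhomogN c p : zhomog c p -> zhomog c (- p).
Proof. by case: c => c /=; [rewrite rpredN | move=> ->; rewrite oppr0]. Qed.

Lemma zhomogM c e p q : zhomog c p -> zhomog e q -> zhomog (c + e) (p * q).
Proof.
case: c => c; last by move=> /= ->; rewrite mul0r => _; apply: zhomog0.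
case: e => e; last by move=> _ /= ->; rewrite mulr0; apply: zhomog0.
exact: dhomogM.
Qed.

Lemma zhomogX i : zhomog 1 ('X_i : S).
Proof. by rewrite /= dhomogX; apply/eqP/mdeg1. Qed.

Definition zproj c p : S := mfilter (fun m => (mdeg m)%:Z == c) p.

Lemma mcoeff_zproj c p m : (zproj c p)@_m = if (mdeg m)%:Z == c then p@_m else 0.
Proof. exact: mcoeff_mfilter. Qed.

Lemma zproj_homog c p : zhomog c (zproj c p).
Proof.
apply/zhomogP => m; rewrite mcoeff_zproj; case: ifP => [/eqP //|_].
by rewrite eqxx.
Qed.

Lemma zproj_id c p : zhomog c p -> zproj c p = p.
Proof.
move=> hp; apply/mpolyP => m; rewrite mcoeff_zproj.
by case: ifPn => // /(zhomog_coeff0 hp) ->.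
Qed.

Lemma zproj_ne c e p : zhomog e p -> e != c -> zproj c p = 0.
Proof.
move=> hp ec; apply/mpolyP => m; rewrite mcoeff_zproj mcoeff0.
by case: eqP => // mc; apply: (zhomog_coeff0 hp); rewrite mc eq_sym.
Qed.

Lemma zproj_is_linear c : linear (zproj c).
Proof.
move=> a p q; apply/mpolyP => m; rewrite mcoeffD mcoeffZ !mcoeff_zproj.
by rewrite mcoeffD mcoeffZ; case: ifP; rewrite ?mulr0 ?addr0.
Qed.

HB.instance Definition _ c := GRing.isLinear.Build K S S _ (zproj c)
  (@zproj_is_linear c).

Lemma zprojM c e p q : zhomog e p -> zproj (e + c) (p * q) = p * zproj c q.
Proof.
move=> hp; rewrite {1}(mpolyE q) mulr_sumr linear_sum /=.
rewrite [in RHS](mpolyE q) linear_sum mulr_sumr; apply: eq_bigr => m _ /=.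
have hX : zhomog (mdeg m)%:Z (q@_m *: 'X_[m]).
  by rewrite /= rpredZ // dhomogX.
have hpX := zhomogM hp hX.
have [mc|mc] := eqVneq (mdeg m)%:Z c.
  by rewrite -mc (zproj_id hX) (zproj_id hpX).
by rewrite (zproj_ne hX mc) (zproj_ne hpX) ?mulr0 // (inj_eq (addrI _)).
Qed.

(* Homogeneous elements of degree [c] of the sum of the S(- sh a). *)
Definition vhom k (sh : 'I_k -> int) c (v : 'rV[S]_k) : Prop :=
  forall a, zhomog (c - sh a) (v 0 a).

Definition vproj k (sh : 'I_k -> int) c (v : 'rV[S]_k) : 'rV[S]_k :=
  \row_a zproj (c - sh a) (v 0 a).

Section Vectors.
Variables (k : nat) (sh : 'I_k -> int).
Implicit Types (v w : 'rV[S]_k).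

Lemma vhom0 c : vhom sh c 0.
Proof. by move=> a; rewrite mxE; apply: zhomog0. Qed.

Lemma vhomD c v w : vhom sh c v -> vhom sh c w -> vhom sh c (v + w).
Proof. by move=> hv hw a; rewrite mxE; apply: zhomogD. Qed.

Lemma vhomN c v : vhom sh c v -> vhom sh c (- v).
Proof. by move=> hv a; rewrite mxE; apply: zhomogN. Qed.

Lemma vhomZ c e p v : zhomog e p -> vhom sh c v -> vhom sh (c + e) (p *: v).
Proof.
by move=> hp hv a; rewrite mxE addrAC addrC; apply: zhomogM.
Qed.

Lemma vproj_hom c v : vhom sh c (vproj sh c v).
Proof. by move=> a; rewrite mxE; apply: zproj_homog. Qed.

Lemma vproj_id c v : vhom sh c v -> vproj sh c v = v.
Proof. by move=> hv; apply/rowP => a; rewrite mxE zproj_id. Qed.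

Lemma vprojZ c e p v : zhomog e p -> vproj sh (c + e) (p *: v) = p *: vproj sh c v.
Proof.
by move=> hp; apply/rowP => a; rewrite !mxE -(zprojM _ _ hp); congr zproj; ring.
Qed.

End Vectors.

Lemma vproj_mul k l (sk : 'I_k -> int) (sl : 'I_l -> int) (A : 'M[S]_(k, l)) c v :
  (forall a b, zhomog (sk a - sl b) (A a b)) ->
  vproj sl c (v *m A) = vproj sk c v *m A.
Proof.
move=> hA; apply/rowP => b; rewrite !mxE linear_sum /=; apply: eq_bigr => a _.
by rewrite mxE mulrC [RHS]mulrC -(zprojM _ _ (hA a b)); congr zproj; ring.
Qed.

(* [v] belongs to the submodule generated by the ['X_i *: w] with [i] in [s]. *)
Definition in_varideal k (s : seq 'I_n) (v : 'rV[S]_k) : Prop :=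
  forall a m, (forall i, i \in s -> m i = 0%N) -> (v 0 a)@_m = 0.

Lemma mcoeffXM0 p m i : m i = 0%N -> ('X_i * p)@_m = 0.
Proof.
move=> mi0; rewrite (mpolyE p) mulr_sumr raddf_sum big1 //= => m' _.
rewrite -scalerAr -mpolyXD mcoeffZ mcoeffX; case: eqP => [mE|]; last by rewrite mulr0.
by move: mi0; rewrite -mE mnmDE mnm1E eqxx.
Qed.

Lemma mcoeffXM p m i : ('X_i * p)@_(U_(i) + m) = p@_m.
Proof. by rewrite mulrC mcoeffMX. Qed.

Section VarIdeal.
Variable k : nat.
Implicit Types (s : seq 'I_n) (v w : 'rV[S]_k).

Lemma in_varidealD s v w :
  in_varideal s v -> in_varideal s w -> in_varideal s (v + w).
Proof. by move=> hv hw a m hm; rewrite mxE mcoeffD hv // hw // addr0. Qed.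

Lemma in_varidealN s v : in_varideal s v -> in_varideal s (- v).
Proof. by move=> hv a m hm; rewrite mxE mcoeffN hv // oppr0. Qed.

Lemma in_varideal_cons s i v : in_varideal s v -> in_varideal (i :: s) v.
Proof. by move=> hv a m hm; apply: hv => j js; apply: hm; rewrite inE js orbT. Qed.

Lemma in_varidealX s i v : i \in s -> in_varideal s ('X_i *: v).
Proof. by move=> i_s a m hm; rewrite mxE mcoeffXM0 // hm. Qed.

(** The coefficient of v at m is that of ['X_i *: v] at [U_(i) + m], and this monomial still avoids
    [s] because i does not belong to [s]. *)
Lemma in_varideal_regular s i v :
  i \notin s -> in_varideal s ('X_i *: v) -> in_varideal s v.
Proof.
move=> ins hv a m hm; rewrite -(mcoeffXM _ _ i).
have := hv a (U_(i) + m)%MM; rewrite mxE; apply => j js.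
rewrite mnmDE mnm1E hm // addn0; case: eqP => // ij.
by rewrite ij js in ins.
Qed.

(** The monomials divisible by ['X_i] are collected and divided by it, which gives w. The remaining
    monomials of v avoid ['X_i], hence involve a variable of [s]. *)
Lemma in_varideal_split (sh : 'I_k -> int) s i c v :
  vhom sh c v -> in_varideal (i :: s) v ->
  exists2 w, vhom sh (c - 1) w & in_varideal s (v - 'X_i *: w).
Proof.
move=> hv sv.
pose quo p : S := \sum_(m <- msupp p | m i != 0%N) p@_m *: 'X_[m - U_(i)].
have quoE p : 'X_i * quo p = mfilter (fun m => m i != 0%N) p.
  rewrite /quo mulr_sumr; apply: eq_bigr => m mi0.
  rewrite -scalerAr -mpolyXD addmC submK //.
  apply/mnm_lepP => j; rewrite mnm1E; case: eqP => // <-; by rewrite lt0n.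
have quo_hom e p : zhomog e p -> zhomog (e - 1) (quo p).
  move=> hp; apply/zhomogP => m; rewrite -(mcoeffXM _ _ i) quoE mcoeff_mfilter.
  case: ifP => _; last by rewrite eqxx.
  move/(zhomogP _ _).1: hp => hp /hp; rewrite mdegD mdeg1 => <-; lia.
exists (\row_a quo (v 0 a)) => [a|a m hm].
  by rewrite mxE addrAC; apply: quo_hom.
rewrite !mxE quoE mcoeffB mcoeff_mfilter.
case: eqP => mi0 /=; last by rewrite subrr.
rewrite subr0; apply: sv => j; rewrite inE => /predU1P[->|/hm] //.
Qed.

End VarIdeal.

(** * Exactness of the Koszul complex on a set of variables *)

Local Notation X s := [seq ('X_i : S) | i <- s].

Lemma kall_vhom_diff k (sh : 'I_k -> int) s c (u : koszul 'rV[S]_k (X s)) :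
  kall (vhom sh c) u -> kall (vhom sh (c + 1)) (kdiff u).
Proof.
apply: kall_diff; [exact: vhom0 | exact: vhomD | exact: vhomN |].
by move=> x v /mapP [i _ ->]; apply: vhomZ; apply: zhomogX.
Qed.

Lemma in_varideal_aug_diff k s (u : koszul 'rV[S]_k (X s)) :
  in_varideal s (kaug (kdiff u)).
Proof.
elim: s u => [|i s IH] u /=; first by move=> a m _; rewrite mxE mcoeff0.
rewrite linearD linearZ /=; apply: in_varidealD.
  exact/in_varideal_cons/IH.
by apply: in_varidealX; rewrite mem_head.
Qed.

(** Distinct variables form a regular sequence, so homology occurs only in exterior degree 0, where
    it is the quotient by the ideal of the variables. The induction runs through the mapping cone,
    with z = z0 + e_i /\ z1. *)
Lemma koszul_exact k (sh : 'I_k -> int) s c (z : koszul 'rV[S]_k (X s)) :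
  uniq s -> kall (vhom sh c) z -> kdiff z = 0 -> in_varideal s (kaug z) ->
  exists2 w, kall (vhom sh (c - 1)) w & z = kdiff w.
Proof.
elim: s z => [|i s IH] z.
  move=> _ _ _ z0; exists 0; first exact: vhom0.
  by apply/rowP => a; rewrite !mxE; apply/mpolyP => m; rewrite mcoeff0 z0.
have [z0 [z1 ->]] : exists z0 z1 : koszul 'rV[S]_k (X s), z = (z0, z1).
  by exists z.1, z.2; case: z.
move=> /= /andP[ins us] [hz0 hz1] [dz0 dz1] sz.
have {}dz1 : kdiff z1 = 0 by rewrite -[LHS]opprK dz1 oppr0.
have [] := IH z1 us hz1 dz1.
  (* The cycle condition gives X_i z1 = - d z0, whose part of exterior degree 0 lies in the ideal of
     [s]. *)
  apply: (in_varideal_regular ins).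
  rewrite -linearZ /= -[Y in kaug Y](addKr (kdiff z0)) dz0 addr0 linearN.
  exact/in_varidealN/in_varideal_aug_diff.
move=> w1 hw1 z1E.
have hz : kall (vhom sh c) (z0 + 'X_i *: w1).
  apply: kallD hz0 _; first exact: vhomD.
  by apply: kallZ hw1 => v /(vhomZ (zhomogX i)); rewrite subrK.
have [|v hv sv] := in_varideal_split (kall_aug hz) (s := s) (i := i).
  rewrite linearD linearZ /=; apply: in_varidealD => //.
  by apply: in_varidealX; rewrite mem_head.
(* With z1 = d w1, the chain z0 + X_i w1 is a cycle. Subtracting X_i v moves its augmentation from
   the ideal of [i :: s] into that of [s]. *)
have [|||w0 hw0 w0E] := IH (z0 + 'X_i *: w1 - 'X_i *: kinj (X s) v) us.
- apply: kallD hz _; first exact: vhomD.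
  apply: kallN; first exact: vhomN.
  apply: (@kallZ _ _ (vhom sh (c - 1))).
    by move=> a /(vhomZ (zhomogX i)); rewrite subrK.
  by apply: kall_inj; first exact: vhom0.
- by rewrite linearB linearD !linearZ /= kdiff_inj oppr0 scaler0 addr0 -z1E.
- by rewrite linearB linearZ /= kaug_inj.
exists (w0, kinj (X s) v - w1).
  split=> //=.
  apply: (@kallD _ _ _ (vhom sh (c - 1)) (vhom sh (c - 1))); first exact: vhomD.
    by apply: kall_inj; first exact: vhom0.
  by apply: kallN; first exact: vhomN.
congr pair; last by rewrite linearB /= kdiff_inj sub0r opprK.
by rewrite -w0E scalerBr addrA subrK addrK.
Qed.

End Graded.

(** * Degrees of a minimal resolution *)

Section Resolution.
Variables (K : fieldType) (n : nat) (t : 'I_n).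
Local Notation S := {mpoly K[n]}.
Variables (I : S -> Prop) (F : free_sequence K n).
Hypothesis resF : minimal_graded_free_resolution I F.

Local Notation V q := ('rV[S]_(rank F q)).
Local Notation vh q := (vhom (@shift K n F q)).

(** The variable t comes first, so that [khomotopy] and [kcotop_diff1] concern multiplication by
    ['X_t]. *)
Let vars : seq 'I_n := t :: rem t (enum 'I_n).
Local Notation xs := [seq ('X_i : S) | i <- vars].
Local Notation C q := (koszul (V q : lmodType S) xs).

Let uniq_vars : uniq vars.
Proof. by rewrite /= mem_rem_uniqF ?rem_uniq ?enum_uniq. Qed.

Let mem_vars i : i \in vars.
Proof.
rewrite inE mem_rem_uniq ?enum_uniq // inE mem_enum inE andbT.
by case: eqP.
Qed.

Definition resd q : {linear V q.+1 -> V q} := mulmxr (diff F q).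
Arguments resd : simpl never.

Definition resd_im q (v : V q) : Prop := exists w, v = resd q w.

Lemma resdK q v : resd q (resd q.+1 v) = 0.
Proof. by apply/(res_exact resF); exists v. Qed.

Lemma resd_im0 q : @resd_im q 0.
Proof. by exists 0; rewrite linear0. Qed.

Lemma resd_imD q v w : @resd_im q v -> @resd_im q w -> @resd_im q (v + w).
Proof. by move=> [a ->] [b ->]; exists (a + b); rewrite linearD. Qed.

Lemma resd_imZ q x v : @resd_im q v -> @resd_im q (x *: v).
Proof. by move=> [a ->]; exists (x *: a); rewrite linearZ. Qed.

Lemma resd_proj q c v :
  vproj (@shift K n F q) c (resd q v) = resd q (vproj (@shift K n F q.+1) c v).
Proof. by apply: vproj_mul => a b; apply: (res_diff_graded resF). Qed.

Lemma resd_hom_lift q c v : vh q c v -> resd_im v ->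
  exists2 w, vh q.+1 c w & v = resd q w.
Proof.
move=> hv [w vE]; exists (vproj (@shift K n F q.+1) c w); first exact: vproj_hom.
by rewrite -resd_proj -vE vproj_id.
Qed.

Lemma kmap_resd_hom q c (z : C q.+1) :
  kall (vh q.+1 c) z -> kall (vh q c) (kmap (resd q) z).
Proof.
move=> hz; apply/kall_map; apply: kall_impl hz => v hv.
by rewrite -(vproj_id hv) -resd_proj; apply: vproj_hom.
Qed.

Lemma kall_resd_im q c (z : C q) : kall (vh q c) z ->
  kall (@resd_im q) z -> exists2 w, kall (vh q.+1 c) w & z = kmap (resd q) w.
Proof.
move=> hz bz; apply: (@kall_choice _ _ _ (fun v => vh q c v /\ resd_im v)).
  by move=> v []; apply: resd_hom_lift.
elim: xs z hz bz => [|x s IH] z //= [h1 h2] [b1 b2]; split; exact: IH.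
Qed.

Lemma kmap_resd_ker q (z : C q.+1) :
  kmap (resd q) z = 0 -> kall (@resd_im q.+1) z.
Proof.
elim: xs z => [|x s IH] z /=; first by move/(res_exact resF).
by case: z => z1 z2 /= [] /IH h1 /IH h2.
Qed.

Lemma kall_resd_imP q (z : C q) :
  kall (@resd_im q) z <-> exists w, z = kmap (resd q) w.
Proof.
split=> [/kall_choice|[w ->]].
  case/(_ _ (fun=> True) (resd q)) => [v [w ->]|w _ ->]; first by exists w.
  by exists w.
by apply/kall_map; elim: xs w => [|x s IH] w /=; [exists w|].
Qed.

Lemma kaug_diff_const0 q (z : C q) a : (kaug (kdiff z) 0 a)@_0%MM = 0.
Proof. by apply: in_varideal_aug_diff => i _; rewrite mnm0E. Qed.

(** Minimality of the resolution enters here: the entries of its matrices have no constant term. *)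
Lemma kaug_resd_const0 q (z : C q.+1) a : (kaug (kmap (resd q) z) 0 a)@_0%MM = 0.
Proof.
rewrite kaug_map mxE raddf_sum big1 //= => b _.
by rewrite rmorphM /= (res_minimal resF) mulr0.
Qed.

(** All variables occur in [vars], so the ideal condition of [koszul_exact] only concerns constant
    terms. *)
Lemma koszul_exact0 q c (z : C q) : kall (vh q c) z -> kdiff z = 0 ->
  (forall a, (kaug z 0 a)@_0%MM = 0) -> exists2 w, kall (vh q (c - 1)) w & z = kdiff w.
Proof.
move=> hz dz z0; apply: koszul_exact => // a m hm.
suff -> : m = 0%MM by [].
by apply/mnmP => i; rewrite mnm0E hm.
Qed.

(* The Koszul homology of coker(F_(q+1) -> F_q), with coefficients in degrees
   above [N + q], vanishes. *)
Definition koszul_acyclic (N : int) q : Prop :=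
  forall c (z : C q), N + q%:Z < c -> kall (vh q c) z ->
  kall (@resd_im q) (kdiff z) ->
  exists u w, [/\ kall (vh q (c - 1)) u, kall (vh q.+1 c) w
    & z = kdiff u + kmap (resd q) w].

(** The image of z in F_q is a cycle, and by minimality it has no constant term, so it is d w with w
    of degree c - 1. The hypothesis at q writes w as a boundary plus the image of some w', and z - d
    w' is then killed by the map to F_q, hence comes from F_(q+2). *)
Lemma koszul_acyclicS N q : koszul_acyclic N q -> koszul_acyclic N q.+1.
Proof.
move=> acN c z Nc hz /kall_resd_imP [y dzE].
have [||a|w hw wE] := @koszul_exact0 q c (kmap (resd q) z).
- exact: kmap_resd_hom.
- by rewrite kdiff_map dzE (kmap_comp0 _ (@resdK q)).
- exact: kaug_resd_const0.
have [||u [w' [_ hw' w'E]]] := acN (c - 1) w _ hw.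
- by move: Nc; rewrite -addn1 PoszD; lia.
- by rewrite -wE; apply/kall_resd_imP; exists z.
have hv : kall (vh q.+1 c) (z - kdiff w').
  apply: (kallD (@vhomD _ _ _ _ c) hz); apply: kallN; first exact: vhomN.
  by rewrite -[c](subrK 1); apply: kall_vhom_diff.
have [|v hv' vE] := kall_resd_im hv.
  apply: kmap_resd_ker; rewrite kmapB -kdiff_map wE w'E.
  by rewrite kdiffD kdiffK add0r kdiff_map subrr.
by exists w', v; split=> //; rewrite -vE addrC subrK.
Qed.

(** A basis vector of larger degree, placed in exterior degree 0, would be a boundary plus an image.
    Both have constant term 0, while the basis vector has constant term 1. *)
Lemma koszul_acyclic_shift N q (a : 'I_(rank F q)) :
  koszul_acyclic N q -> shift a <= N + q%:Z.
Proof.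
move=> acN; rewrite leNgt; apply/negP => Na.
pose e : V q := delta_mx 0 a.
have he : vh q (shift a) e.
  move=> b; rewrite mxE eqxx /=; case: eqVneq => [->|_].
    by rewrite subrr; apply: dhomog1.
  exact: zhomog0.
have [||u [w [_ _ eE]]] := acN _ (kinj xs e) Na.
- by apply: kall_inj => //; apply: vhom0.
- by rewrite kdiff_inj; apply: kall0; apply: resd_im0.
have : (kaug (kinj xs e) 0 a)@_0%MM = 0.
  by rewrite eE kaugD mxE mcoeffD kaug_diff_const0 kaug_resd_const0 addr0.
by rewrite kaug_inj mxE !eqxx mcoeff1 eqxx => /eqP; rewrite oner_eq0.
Qed.

(** The reverse chase: d z is the image of some y of degree c + 1, the hypothesis at q + 1 gives y =
    d u + (an image), and z minus the image of u is a cycle. *)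
Lemma koszul_acyclic_pred N q :
  (forall a : 'I_(rank F q), shift a <= N + q%:Z) ->
  koszul_acyclic N q.+1 -> koszul_acyclic N q.
Proof.
move=> leN acN c z Nc hz bz.
have [y hy dzE] := kall_resd_im (kall_vhom_diff hz) bz.
have [||u [w [hu _ yE]]] := acN (c + 1) y _ hy.
- by move: Nc; rewrite -addn1 PoszD; lia.
- apply: kmap_resd_ker; rewrite -kdiff_map -dzE; exact: kdiffK.
rewrite addrK in hu.
have hv : kall (vh q c) (z - kmap (resd q) u).
  apply: (kallD (@vhomD _ _ _ _ c) hz); apply: kallN; first exact: vhomN.
  exact: kmap_resd_hom.
have [||v hv' vE] := koszul_exact0 hv.
- rewrite kdiffB dzE yE kmapD !kdiff_map (kmap_comp0 _ (@resdK q)).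
  by rewrite addr0 subrr.
(* A constant term of z at a would force c = [shift a], but [shift a] is at most N + q, which is
   less than c. *)
- move=> a; rewrite kaugB !mxE mcoeffB kaug_resd_const0 subr0.
  apply: zhomog_coeff0 (kall_aug hz a) _; rewrite mdeg0.
  by apply/eqP => /eqP; have := leN a; lia.
by exists v, u; split=> //; rewrite -vE subrK.
Qed.

Lemma koszul_acyclic_nil N q : rank F q = 0%N -> koszul_acyclic N q.
Proof.
move=> r0 c z _ _ _; exists 0, 0; split.
- by apply: kall0; apply: vhom0.
- by apply: kall0; apply: vhom0.
rewrite kdiff0 kmap0 addr0; apply: koszul_eq0.
elim: xs z => [|x s IH] z /=; last by split; apply: IH.
by apply/rowP => a; case: (cast_ord r0 a).
Qed.

Lemma koszul_acyclic_resolution N :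
  (forall q (a : 'I_(rank F q)), shift a <= N + q%:Z) ->
  forall q, koszul_acyclic N q.
Proof.
move=> leN; have [m Fm] := res_finite resF.
(* Descending induction from m + 1, where the resolution has stopped. *)
suff acN k : koszul_acyclic N (m.+1 - k).
  move=> q; have [qm|mq] := leqP q m; last exact: koszul_acyclic_nil (Fm _ mq).
  by rewrite -(subKn (leqW qm)).
elim: k => [|k IH]; first by rewrite subn0; apply: koszul_acyclic_nil; apply: Fm.
(* Once k exceeds m, the truncated difference stays at 0. *)
have [km|mk] := leqP m.+1 k.
  by move: IH; rewrite subnS; move: km; rewrite -subn_eq0 => /eqP ->.
by apply: koszul_acyclic_pred => //; rewrite subnS prednK // subn_gt0.
Qed.

(** * Reduction modulo a variable that is regular on S/I *)

Hypothesis I_add : forall f g, I f -> I g -> I (f + g).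
Hypothesis I_mul : forall h f, I f -> I (h * f).
Hypothesis I_proj : forall c f, I f -> I (zproj c f).
Hypothesis I_regular : forall f, I ('X_t * f) -> I f.

Definition in_sum_ideal (f : S) : Prop := exists g, I (f - 'X_t * g).

Definition evalF (v : V 0) : S := (v *m aug F) 0 0.

Lemma evalF_is_linear : linear_for *%R evalF.
Proof. by move=> x u v; rewrite /evalF mulmxDl -scalemxAl !mxE. Qed.

HB.instance Definition _ := GRing.isLinear.Build S (V 0) S _ evalF
  evalF_is_linear.

Lemma resd_im_eval v : @resd_im 0 v <-> I (evalF v).
Proof. by split=> [/(res_exact0 resF)|/(res_exact0 resF)]. Qed.

Lemma resd_im_regular v : @resd_im 0 ('X_t *: v) -> @resd_im 0 v.
Proof. by move/resd_im_eval; rewrite linearZ => /I_regular /resd_im_eval. Qed.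

Lemma evalF_proj c v :
  evalF (vproj (@shift K n F 0) c v) = zproj c (evalF v).
Proof.
rewrite /evalF !mxE linear_sum /=; apply: eq_bigr => a _.
have := res_aug_graded resF a; rewrite mxE => ha.
rewrite mulrC [in RHS]mulrC -(zprojM _ _ ha); congr zproj; ring.
Qed.

Lemma evalF_hom c v : vh 0 c v -> zhomog c (evalF v).
Proof. by move=> hv; rewrite -(vproj_id hv) evalF_proj; apply: zproj_homog. Qed.

(** A preimage of g in F_0 need not be homogeneous; its part of degree c - 1 serves, because I is
    closed under taking homogeneous components. *)
Lemma resd_im_var_lift c v : vh 0 c v -> in_sum_ideal (evalF v) ->
  exists2 w, vh 0 (c - 1) w & @resd_im 0 (v - 'X_t *: w).
Proof.
move=> hv [g Ig]; have [w Iw] := res_aug_surj resF g.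
exists (vproj (@shift K n F 0) (c - 1) w); first exact: vproj_hom.
rewrite -(vprojZ _ _ _ (zhomogX _ t)) subrK.
have -> : v - vproj (@shift K n F 0) c ('X_t *: w)
        = vproj (@shift K n F 0) c (v - 'X_t *: w).
  rewrite -{1}(vproj_id hv) -scaleN1r; apply/rowP => a.
  by rewrite !mxE linearB /= mulN1r.
apply/resd_im_eval; rewrite evalF_proj; apply: I_proj.
rewrite linearB linearZ /=.
have -> : evalF v - 'X_t * evalF w = (evalF v - 'X_t * g) + 'X_t * (g - evalF w) by ring.
by apply: I_add => //; apply: I_mul.
Qed.

Lemma koszul_var_lift c (z : C 0) : kall (vh 0 c) z ->
  (forall f, zhomog c f -> in_sum_ideal f) ->
  exists y w, [/\ kall (vh 0 (c - 1)) y, kall (vh 1 c) w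
    & z = 'X_t *: y + kmap (resd 0) w].
Proof.
move=> hz sumI.
have [y hy yE] : exists2 y : C 0, kall (vh 0 (c - 1)) y
    & kall (@resd_im 0) (z - 'X_t *: y).
  elim: xs z hz => [|x s IH] z /=.
    by move=> hz; apply: (resd_im_var_lift hz); apply/sumI/evalF_hom.
  case=> /IH [y1 hy1 b1] /IH [y2 hy2 b2].
  by exists (y1, y2).
have [|w hw wE] := kall_resd_im _ yE (c := c).
  apply: (kallD (@vhomD _ _ _ _ c) hz); apply: kallN; first exact: vhomN.
  by rewrite -[c](subrK 1); apply: kallZ hy => v; apply: vhomZ; apply: zhomogX.
by exists y, w; split=> //; rewrite -wE addrC subrK.
Qed.

Lemma kall_resd_im_regular (z : C 0) :
  kall (@resd_im 0) ('X_t *: z) -> kall (@resd_im 0) z.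
Proof.
elim: xs z => [|x s IH] z /=; first exact: resd_im_regular.
by case=> /IH ? /IH ?.
Qed.

(** Modulo the image of F_1, z equals X_t y, and regularity of ['X_t] makes y a cycle there too. The
    homotopy then exhibits X_t y as a boundary. *)
Lemma koszul_acyclic0 N :
  (forall c f, N < c -> zhomog c f -> in_sum_ideal f) -> koszul_acyclic N 0.
Proof.
move=> sumI c z; rewrite addr0 => Nc hz bz.
have [y [w [hy hw zE]]] := koszul_var_lift hz (fun f => sumI c f Nc).
have bdy : kall (@resd_im 0) (kdiff y).
  apply: kall_resd_im_regular; rewrite -kdiffZ -[_ *: y](addrK (kmap (resd 0) w)).
  rewrite -zE kdiffB kdiff_map; apply: (kallD (@resd_imD 0) bz).
  apply: kallN; last by apply/kall_resd_imP; exists (kdiff w).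
  by move=> v; rewrite -scaleN1r; apply: resd_imZ.
have hdy : kall (vh 0 c) (kdiff y).
  by rewrite -[c](subrK 1); apply: kall_vhom_diff.
have [||w' hw' w'E] := @kall_resd_im 0 c (khomotopy (kdiff y)).
- by apply: kall_homotopy hdy; apply: vhom0.
- by apply: kall_homotopy bdy; apply: resd_im0.
exists (khomotopy y), (w' + w); split.
- by apply: kall_homotopy hy; apply: vhom0.
- exact: (kallD (@vhomD _ _ _ _ c) hw' hw).
- by rewrite kmapD addrA -w'E -khomotopyP.
Qed.

(* For [f] of degree [c], the cycle [kdiff (ktop f) / 'X_t] of degree [c] is a
   boundary [kdiff u], and [f] is ['X_t] times the top coefficient of [u]. *)
Lemma in_sum_ideal_descend N c : koszul_acyclic N 0 -> N < c ->
  (forall f, zhomog (c + 1) f -> in_sum_ideal f) ->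
  forall f, zhomog c f -> in_sum_ideal f.
Proof.
move=> acN Nc sumI f hf; have [v0 Iv0] := res_aug_surj resF f.
pose v := vproj (@shift K n F 0) c v0.
have Iv : I (f - evalF v).
  by rewrite evalF_proj -{1}(zproj_id hf) -linearB; apply: I_proj.
have hz : kall (vh 0 (c + 1)) (kdiff (ktop xs v)).
  by apply/kall_vhom_diff/kall_top; [apply: vhom0 | apply: vproj_hom].
(* The coefficients of d (ktop v) have degree c + 1, so by [sumI] they are divisible by ['X_t]
   modulo the image of F_1; y is the quotient. *)
have [y [w [hy _ zE]]] := koszul_var_lift hz sumI; rewrite addrK in hy.
have [||u [w' [_ _ yE]]] := acN c y _ hy; first by rewrite addr0.
  apply: kall_resd_im_regular; rewrite -kdiffZ -[_ *: y](addrK (kmap (resd 0) w)).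
  rewrite -zE kdiffB kdiffK sub0r kdiff_map.
  apply: kallN; last by apply/kall_resd_imP; exists (kdiff w).
  by move=> a; rewrite -scaleN1r; apply: resd_imZ.
have : kall (@resd_im 0) (kdiff (ktop xs v - 'X_t *: u)).
  have -> : kdiff (ktop xs v - 'X_t *: u) = kmap (resd 0) (w + 'X_t *: w').
    rewrite kdiffB kdiffZ zE yE kmapD kmapZ scalerDr.
    by rewrite addrAC ['X_t *: kdiff u + _]addrC addrK addrC.
  by apply/kall_resd_imP; exists (w + 'X_t *: w').
(* The coefficient of the product of all generators but the first is ['X_t] times v - X_t (kcotop
   u), and ['X_t] cancels. *)
case=> /kall_cotop; rewrite kcotop_diff1 => /resd_im_regular /resd_im_eval Iu _.
exists (evalF (kcotop u)).
have := I_add Iv Iu; rewrite linearB linearZ /= kcotop_top linearB linearZ /=.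
by rewrite addrA subrK.
Qed.

Lemma betti_shift i (a : 'I_(rank F i)) : betti F i (shift a) != 0%N.
Proof. by rewrite -lt0n; apply/card_gt0P; exists a; rewrite inE. Qed.

(** Acyclicity lets the membership descend one degree at a time, from the degree d beyond which it
    is given down to the first degree above r. *)
Lemma in_sum_ideal_of_betti r :
  (forall i j, betti F i j != 0%N -> j - i%:Z <= r) ->
  (exists d, forall c f, d <= c -> zhomog c f -> in_sum_ideal f) ->
  forall c f, r < c -> zhomog c f -> in_sum_ideal f.
Proof.
move=> ler [d sumd].
have acr : koszul_acyclic r 0.
  apply: koszul_acyclic_resolution => i a.
  by rewrite -lerBlDr; apply/ler/betti_shift.
suff H (k : nat) c : r < c -> d <= c + k%:Z ->
    forall f, zhomog c f -> in_sum_ideal f.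
  by move=> c f rc; apply: (H `|d - c|%N) => //; lia.
elim: k c => [|k IH] c rc dc f; first by apply: sumd; rewrite addr0 in dc.
apply: (in_sum_ideal_descend acr rc) => g; apply: IH; lia.
Qed.

Lemma betti_le_of_in_sum_ideal N :
  (forall c f, N < c -> zhomog c f -> in_sum_ideal f) ->
  forall i j, betti F i j != 0%N -> j - i%:Z <= N.
Proof.
move=> sumI i j; rewrite -lt0n => /card_gt0P [a]; rewrite inE => /eqP <-.
rewrite lerBlDr; apply: koszul_acyclic_shift.
by elim: i {a} => [|i]; [apply: koszul_acyclic0 | apply: koszul_acyclicS].
Qed.

End Resolution.

(** * Vanishing ideals of toric subsets *)

Section GeneratedIdeal.
Variables (R : comNzRingType) (P : R -> Prop).
Local Notation J := (ideal_generated_by P).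

Lemma ideal_gen0 : J 0.
Proof.
by exists 0%N, (fun=> 0), (fun=> 0); split=> [[]|]; rewrite ?big_ord0.
Qed.

Lemma ideal_genD f g : J f -> J g -> J (f + g).
Proof.
move=> [m [c [h [Ph ->]]]] [m' [c' [h' [Ph' ->]]]].
exists (m + m')%N.
exists (fun i => match split i with inl j => c j | inr j => c' j end).
exists (fun i => match split i with inl j => h j | inr j => h' j end).
split=> [i|]; first by case: (split i).
rewrite big_split_ord /=; congr (_ + _); apply: eq_bigr => i _.
  by rewrite (unsplitK (inl i)).
by rewrite (unsplitK (inr i)).
Qed.

Lemma ideal_genM a f : J f -> J (a * f).
Proof.
move=> [m [c [h [Ph ->]]]]; exists m, (fun i => a * c i), h; split=> //.
by rewrite mulr_sumr; apply: eq_bigr => i _; rewrite mulrA.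
Qed.

Lemma ideal_gen_mem f : P f -> J f.
Proof.
by move=> Pf; exists 1%N, (fun=> 1), (fun=> f); rewrite big_ord1 mul1r.
Qed.

Lemma ideal_gen_sum (T : Type) (r : seq T) (Q : pred T) (f : T -> R) :
  (forall i, Q i -> J (f i)) -> J (\sum_(i <- r | Q i) f i).
Proof.
by move=> Jf; elim/big_ind: _ => //; [apply: ideal_gen0 | apply: ideal_genD].
Qed.

End GeneratedIdeal.

Lemma zproj_sum (K : fieldType) n (p : {mpoly K[n]}) :
  p = \sum_(d < msize p) zproj d%:Z p.
Proof.
apply/mpolyP => m; rewrite raddf_sum /=.
under eq_bigr do rewrite mcoeff_zproj.
have [mp|mp] := boolP (m \in msupp p); last first.
  by rewrite (memN_msupp_eq0 mp) big1 // => d _; rewrite if_same.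
have dm : (mdeg m < msize p)%N by apply: msize_mdeg_lt.
rewrite (bigD1 (Ordinal dm)) //= eqxx big1 ?addr0 // => d dne.
by rewrite ifF //; apply/negbTE; apply: contraNneq dne => -[] dE; apply/eqP/val_inj.
Qed.

Lemma in_sum_ideal_of_monomials (K : fieldType) n (P : {mpoly K[n]} -> Prop)
    (t : 'I_n) c :
  (forall m, (mdeg m)%:Z = c -> in_sum_ideal t (ideal_generated_by P) 'X_[m]) ->
  forall f, zhomog c f -> in_sum_ideal t (ideal_generated_by P) f.
Proof.
move=> sumX f /zhomogP hf; rewrite (mpolyE f) big_seq.
elim/big_ind: _ => [|f1 f2 [g1 I1] [g2 I2]|m ms].
- by exists 0; rewrite mulr0 subr0; apply: ideal_gen0.
- exists (g1 + g2).
  have -> : f1 + f2 - 'X_t * (g1 + g2) = (f1 - 'X_t * g1) + (f2 - 'X_t * g2) by ring.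
  exact: ideal_genD.
have [|g Ig] := sumX m; first by apply: hf; rewrite -mcoeff_msupp.
exists (f@_m *: g); rewrite -!mul_mpolyC.
have -> : (f@_m)%:MP * 'X_[m] - 'X_t * ((f@_m)%:MP * g)
        = (f@_m)%:MP * ('X_[m] - 'X_t * g) by ring.
exact: ideal_genM.
Qed.

Lemma in_sum_idealM (K : fieldType) n (P : {mpoly K[n]} -> Prop) (t : 'I_n) h f :
  in_sum_ideal t (ideal_generated_by P) f ->
  in_sum_ideal t (ideal_generated_by P) (h * f).
Proof.
move=> [g Ig]; exists (h * g).
have -> : h * f - 'X_t * (h * g) = h * (f - 'X_t * g) by ring.
exact: ideal_genM.
Qed.

Section Toric.
Variables (K : finFieldType) (V E : finType) (G : graph V E).
Local Notation n := #|edges G|.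
Local Notation S := {mpoly K[n]}.
Local Notation I := (vanishing_ideal K G).
Implicit Types (f g : S) (x : V -> K).

Definition torus x : Prop := forall v, v \in verts G -> x v != 0.

(** For c nonzero and x in the torus, these are the homogeneous coordinate vectors of the points of
    X. *)
Definition cone_point x (c : K) : 'I_n -> K :=
  fun i => (c *: toric_vector G x) 0 i.

Lemma cone_point_neq0 x c i : torus x -> c != 0 -> cone_point x c i != 0.
Proof.
move=> nzx c0; rewrite /cone_point !mxE mulf_neq0 //.
apply/prodf_neq0 => v vi; apply: nzx.
exact: (subsetP (ends_sub (enum_valP i))).
Qed.

Lemma homogeneous_vanishingP f : edges G != set0 ->
  homogeneous_vanishing f <->
  (exists d : nat, f \is d.-homog) /\
  (forall x c, torus x -> c != 0 -> f.@[cone_point x c] = 0).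
Proof.
move=> /set0Pn[e eG]; have i0 : 'I_n := enum_rank_in eG e.
split=> -[hf vf]; split=> //.
  move=> x c nzx c0; apply: (vf <[toric_vector G x]>%VS); first by exists x.
    by apply/vlineP; exists c.
  (* The vector spans a projective point: G has an edge, and the coordinate at that edge is
     nonzero. *)
  apply/eqP => /rowP /(_ i0) /eqP; apply/negP.
  by rewrite [Y in _ == Y]mxE; apply: (cone_point_neq0 i0 nzx c0).
move=> L [x nzx ->] p /vlineP[c ->] p0.
by apply: vf => //; apply: contraNneq p0 => ->; rewrite scale0r.
Qed.

Hypothesis edgesG : edges G != set0.

(** The generators are homogeneous, so membership can be tested on each homogeneous component by
    evaluation. *)
Lemma vanishing_idealP f :
  I f <-> forall d x c, torus x -> c != 0 -> (zproj d f).@[cone_point x c] = 0.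
Proof.
split=> [[m [a [g [hg ->]]]] d x c nzx c0|vf].
  rewrite [zproj d _]linear_sum [LHS]raddf_sum big1 //= => i _.
  have [[e he] vg] := (homogeneous_vanishingP _ edgesG).1 (hg i).
  (* The part of degree d of a multiple of a generator of degree e is the generator times the part
     of degree d - e of the cofactor, which is 0 if d < e. *)
  rewrite mulrC -[d](subrKC e%:Z) (zprojM _ _ (he : zhomog e%:Z _)).
  by rewrite mevalM vg // mul0r.
rewrite (zproj_sum f); apply: ideal_gen_sum => d _; apply: ideal_gen_mem.
apply/homogeneous_vanishingP => //; split=> [|x c]; last exact: vf.
by exists d; apply: (zproj_homog d%:Z f).
Qed.

Lemma vanishing_ideal_proj c f : I f -> I (zproj c f).
Proof.
move=> /vanishing_idealP If; apply/vanishing_idealP => d x a nzx a0.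
have [->|cd] := eqVneq c d.
  by rewrite zproj_id; [apply: If | apply: zproj_homog].
by rewrite (zproj_ne (zproj_homog c f) cd) meval0.
Qed.

Lemma vanishing_ideal_regular t f : I ('X_t * f) -> I f.
Proof.
move=> /vanishing_idealP If; apply/vanishing_idealP => d x c nzx c0.
have := If (1 + d) x c nzx c0; rewrite (zprojM _ _ (zhomogX K t)) mevalM mevalXU.
by move/eqP; rewrite mulf_eq0 (negPf (cone_point_neq0 t nzx c0)) => /eqP.
Qed.

Lemma vanishing_ideal_expX i j : I ('X_i ^+ #|K|.-1 - 'X_j ^+ #|K|.-1).
Proof.
have pow1 (a : K) : a != 0 -> a ^+ #|K|.-1 = 1.
  move=> a0; apply: (mulfI a0); rewrite -exprS mulr1 prednK ?expf_card //.
  exact/ltnW/card_finNzRing_gt1.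
apply: ideal_gen_mem; apply/homogeneous_vanishingP => //.
split=> [|x c nzx c0].
  exists #|K|.-1; rewrite -[Y in Y.-homog]mul1n.
  by apply: rpredB; apply/dhomogMn/(zhomogX K).
by rewrite mevalB !rmorphXn /= !mevalXU !pow1 ?subrr ?cone_point_neq0.
Qed.

(** Write q for the order of K. A monomial of degree above n(q - 1) contains some X_i^(q-1), which
    is congruent to X_t^(q-1) modulo I. *)
Lemma in_sum_ideal_large t :
  exists d, forall c f, d <= c -> zhomog c f -> in_sum_ideal t I f.
Proof.
exists (n * #|K|.-1).+1%:Z => c f dc; apply: in_sum_ideal_of_monomials => m mc.
have [i mi] : exists i, (#|K|.-1 <= m i)%N.
  apply/existsP; apply: contraTT dc; rewrite negb_exists => /forallP mlt.
  rewrite -mc lez_nat -leqNgt mdegE -[X in (_ <= X * _)%N]card_ord -sum_nat_const.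
  by apply: leq_sum => i _; rewrite ltnW // ltnNge.
pose m' := (m - U_(i) *+ #|K|.-1)%MM.
have mE : 'X_[m] = 'X_i ^+ #|K|.-1 * 'X_[m'] :> S.
  rewrite mpolyXn -mpolyXD addmC submK //; apply/mnm_lepP => j.
  by rewrite mulmnE mnm1E; case: eqVneq => [<-|_]; rewrite ?mul1n ?mul0n.
(* The exponent is q - 2 because one factor ['X_t] is split off, which is possible as q > 1. *)
exists ('X_t ^+ #|K|.-2 * 'X_[m']).
rewrite mE mulrA -exprS prednK; last by rewrite -subn1 subn_gt0 card_finNzRing_gt1.
by rewrite -mulrBl mulrC; apply: ideal_genM; apply: vanishing_ideal_expX.
Qed.

Lemma in_sum_ideal_of_regularity t r : regularity I r ->
  forall c f, r < c -> zhomog c f -> in_sum_ideal t I f.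
Proof.
move=> [F resF [_ ler]]; apply: (in_sum_ideal_of_betti resF) ler _.
- exact: ideal_genD.
- exact: ideal_genM.
- exact: vanishing_ideal_proj.
- exact: vanishing_ideal_regular.
- exact: in_sum_ideal_large.
Qed.

Lemma regularity_le t r N : regularity I r ->
  (forall c f, N < c -> zhomog c f -> in_sum_ideal t I f) -> r <= N.
Proof.
move=> [F resF [[i [j [bij ->]]] _]] sumI.
apply: (betti_le_of_in_sum_ideal resF) sumI _ _ bij.
- exact: ideal_genD.
- exact: ideal_genM.
- exact: vanishing_ideal_proj.
- exact: vanishing_ideal_regular.
Qed.

End Toric.

(** * Passage from the edge rings of the subgraphs to that of G *)

Section Subgraph.
Variables (K : finFieldType) (V E : finType) (H G : graph V E) (e0 : E).
Hypotheses (sHG : subgraph H G) (e0H : e0 \in edges H) (e0G : e0 \in edges G).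

(** The edges of H and of G are numbered independently, so an index is carried over through the edge
    itself. *)
Definition edge_incl (i : 'I_#|edges H|) : 'I_#|edges G| :=
  enum_rank_in e0G (enum_val i).

Lemma edge_inclE i : enum_val (edge_incl i) = enum_val i.
Proof.
by case: sHG => _ sE _; rewrite enum_rankK_in // (subsetP sE) ?enum_valP.
Qed.

Definition edge_ring_incl (f : edge_ring K H) : edge_ring K G :=
  f \mPo [tuple 'X_(edge_incl i) | i < #|edges H|].

Lemma edge_ring_inclX i : edge_ring_incl 'X_i = 'X_(edge_incl i).
Proof. by rewrite /edge_ring_incl comp_mpolyXU -tnth_nth tnth_mktuple. Qed.

Lemma edge_ring_incl_homog d f :
  f \is d.-homog -> edge_ring_incl f \is d.-homog.
Proof.
move=> /dhomogP hf; rewrite /edge_ring_incl comp_mpolyEX big_seq rpred_sum // => m ms.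
rewrite rpredZ // -(hf m ms) /= mdegE comp_mpolyX.
apply: (big_rec2 (fun (p : edge_ring K G) e => p \is e.-homog)) => [|i p e _ hp].
  exact: dhomog1.
rewrite tnth_mktuple; apply: dhomogM => //.
by rewrite -[Y in Y.-homog]mul1n; apply: dhomogMn; rewrite dhomogX /= mdeg1.
Qed.

(** A torus point of G is also one of H, and the two cone points with the same scalar agree at the
    edges of H. *)
Lemma edge_ring_incl_vanishing f :
  vanishing_ideal K H f -> vanishing_ideal K G (edge_ring_incl f).
Proof.
have eH : edges H != set0 by apply/set0Pn; exists e0.
have eG : edges G != set0 by apply/set0Pn; exists e0.
move=> [m [a [g [hg ->]]]]; rewrite /edge_ring_incl linear_sum.
apply: ideal_gen_sum => i _; rewrite rmorphM; apply: ideal_genM.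
apply: ideal_gen_mem; have [[d hd] vg] := (homogeneous_vanishingP _ eH).1 (hg i).
apply/homogeneous_vanishingP => //; split=> [|x c nzx c0].
  by exists d; apply: edge_ring_incl_homog.
rewrite comp_mpoly_meval -[RHS](vg x c _ c0); last first.
  by move=> v vH; apply: nzx; case: sHG => sV _ _; apply: (subsetP sV).
apply: meval_eq => j; rewrite tnth_mktuple mevalXU /cone_point !mxE edge_inclE.
by case: sHG => _ _ sE; rewrite /edge_monomial sE ?enum_valP.
Qed.

Lemma edge_ring_incl_sum_ideal f :
  in_sum_ideal (enum_rank_in e0H e0) (vanishing_ideal K H) f ->
  in_sum_ideal (enum_rank_in e0G e0) (vanishing_ideal K G) (edge_ring_incl f).
Proof.
move=> [g /edge_ring_incl_vanishing Ig]; exists (edge_ring_incl g).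
move: Ig; rewrite /edge_ring_incl rmorphB rmorphM /= -/(edge_ring_incl 'X__).
rewrite edge_ring_inclX; congr (vanishing_ideal _ _ (_ - 'X_ _ * _)).
by rewrite /edge_incl enum_rankK_in.
Qed.

Lemma edge_ring_incl_shift i m :
  edge_ring_incl 'X_[U_(i) + m] = 'X_(edge_incl i) * edge_ring_incl 'X_[m].
Proof. by rewrite mpolyXD /edge_ring_incl rmorphM /= -edge_ring_inclX. Qed.

Lemma in_sum_ideal_incl_monomial r m :
  regularity (vanishing_ideal K H) r -> r < (mdeg m)%:Z ->
  in_sum_ideal (enum_rank_in e0G e0) (vanishing_ideal K G)
    (edge_ring_incl 'X_[m]).
Proof.
move=> rH rm; apply: edge_ring_incl_sum_ideal.
have eH : edges H != set0 by apply/set0Pn; exists e0.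
by apply: (in_sum_ideal_of_regularity eH _ rH rm); rewrite /= dhomogX.
Qed.

Lemma edge_incl_onto j : enum_val j \in edges H -> exists i, edge_incl i = j.
Proof.
move=> jH; exists (enum_rank_in jH (enum_val j)); apply: enum_val_inj.
by rewrite edge_inclE enum_rankK_in.
Qed.

End Subgraph.

(** By induction on the degree, each variable is assigned to a subgraph that contains its edge. *)
Lemma monomial_split (K : finFieldType) (V E : finType) (G H1 H2 : graph V E) e0
    (e0G : e0 \in edges G) :
  subgraph H1 G -> subgraph H2 G -> edges G = edges H1 :|: edges H2 ->
  forall m, exists (m1 : 'X_{1..#|edges H1|}) (m2 : 'X_{1..#|edges H2|}),
    'X_[m] = edge_ring_incl e0G 'X_[m1] * edge_ring_incl e0G 'X_[m2]
      :> edge_ring K G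
    /\ mdeg m = (mdeg m1 + mdeg m2)%N.
Proof.
move=> s1 s2 GE m; move mE: (mdeg m) => d.
elim: d m mE => [|d IH] m mE.
  exists 0%MM, 0%MM; rewrite !mdeg0; split=> //.
  move/eqP: mE; rewrite mdeg_eq0 => /eqP ->.
  by rewrite /edge_ring_incl !mpolyX0 !comp_mpoly1 mulr1.
have [j mj] : exists j, m j != 0%N.
  apply/existsP; apply: contra_eqT mE; rewrite negb_exists => /forallP m0.
  by rewrite mdegE big1 // => j _; apply/eqP; rewrite -[_ == _]negbK.
have mE' : m = (U_(j) + (m - U_(j)))%MM.
  rewrite addmC submK //; apply/mnm_lepP => i; rewrite mnm1E.
  by case: eqP => // <-; rewrite lt0n.
move: mE; rewrite mE' mdegD mdeg1 => -[] /IH [m1 [m2 [XE dE]]].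
have : enum_val j \in edges H1 :|: edges H2 by rewrite -GE enum_valP.
case/setUP => [/(edge_incl_onto s1 e0G)|/(edge_incl_onto s2 e0G)] [i iE].
  exists (U_(i) + m1)%MM, m2; rewrite edge_ring_incl_shift iE mpolyXD XE mulrA.
  by rewrite mdegD mdeg1 dE add1n addSn.
exists m1, (U_(i) + m2)%MM; rewrite edge_ring_incl_shift iE mpolyXD XE mulrCA.
by rewrite mdegD mdeg1 dE add1n addnS.
Qed.

Theorem proposition2p6 (K : finFieldType) (V E : finType)
    (G H1 H2 : graph V E) (r r1 r2 : int) :
  no_isolated_vertex G ->
  subgraph H1 G -> subgraph H2 G ->
  edges G = edges H1 :|: edges H2 ->
  edges H1 :&: edges H2 != set0 ->
  regularity (vanishing_ideal K G) r ->
  regularity (vanishing_ideal K H1) r1 ->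
  regularity (vanishing_ideal K H2) r2 ->
  (r <= r1 + r2)%R.
Proof.
move=> _ s1 s2 GE /set0Pn[e /setIP[e1 e2]] rG rH1 rH2.
have eG : e \in edges G by rewrite GE inE e1.
have nzG : edges G != set0 by apply/set0Pn; exists e.
(* The common edge e supplies t, a variable of both subrings. *)
apply: (regularity_le nzG (t := enum_rank_in eG e)) rG _ => c f rc.
apply: in_sum_ideal_of_monomials => m mc.
have [m1 [m2 [-> dE]]] := monomial_split K eG s1 s2 GE m.
have [d1|d1] := ltrP r1 (mdeg m1)%:Z.
  by rewrite mulrC; apply/in_sum_idealM/(in_sum_ideal_incl_monomial s1 e1 eG rH1).
apply/in_sum_idealM/(in_sum_ideal_incl_monomial s2 e2 eG rH2).
by move: rc; rewrite -mc dE PoszD; lia.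
Qed.
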